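(* Let $n\ge 2$ and let $A(t)$ be a geodesic on $\mathsf{SL}(n)$ with the HS metric such that, for some $t_0\in\mathbb{R}$, $\mathrm{II}(A'(t),A'(t))>0$ for all $t>t_0$. Then $|A(t)|$ grows linearly as $t\nearrow\infty$; that is, there are constants $0<c\le C$ such that $ct\le |A(t)|\le Ct$ for all sufficiently large $t$.
   Context: $\mathcal{M}(n)$ is the space of real $n\times n$ matrices with the Hilbert-Schmidt inner product $\langle A,B\rangle=\operatorname{tr}(AB^T)$ and norm $|A|=\sqrt{\langle A,A\rangle}$. The HS metric on $\mathsf{SL}(n)=\{A\in\mathcal{M}(n):\det A=1\}$ is the Riemannian metric induced on it as a submanifold of the Euclidean space $\mathcal{M}(n)$. A curve $A(t)$ in $\mathsf{SL}(n)$ is a geodesic iff \[A''=\frac{\operatorname{tr}(A'A^{-1}A'A^{-1})}{\operatorname{tr}(A^{-1}A^{-T})}A^{-T}.\] The second fundamental form of $\mathsf{SL}(n)\subset\mathcal{M}(n)$ with respect to the unit normal $N(A)=A^{-T}/|A^{-T}|$ is $\mathrm{II}(X,Y)=\operatorname{tr}(A^{-1}XA^{-1}Y)/|A^{-1}|$ for $X,Y\in T_A\mathsf{SL}(n)$. *)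

(* Defs.v *)
From HB Require Import structures.
From mathcomp Require Import all_boot all_order all_algebra all_fingroup.
From mathcomp Require Import all_classical all_reals all_analysis.
Set Implicit Arguments.
Unset Strict Implicit.
Unset Printing Implicit Defensive.
Import Order.TTheory GRing.Theory Num.Theory.
Import numFieldNormedType.Exports.
Local Open Scope classical_set_scope.
Local Open Scope ring_scope.

Definition hsdot (R : realType) (n : nat) (A B : 'M[R]_n) : R :=
  \tr (A *m B^T).

(* The norm `|A| that MathComp-Analysis puts on matrices is the sup norm; it
   defines the same topology, hence the same derivatives, but it is not the
   Hilbert-Schmidt norm. *)
Definition hsnorm (R : realType) (n : nat) (A : 'M[R]_n) : R :=
  Num.sqrt (hsdot A A).

Definition SL (R : realType) (n : nat) : set 'M[R]_n :=
  [set A | \det A = 1].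

(* The tangent space at A in SL(n) is the kernel of the differential at A of
   the defining function det (1 is a regular value of det); see tangentSLP. *)
Definition tangentSL (R : realType) (n : nat) (A : 'M[R]_n) : set 'M[R]_n :=
  [set X | 'D_X (fun M : 'M[R]_n => \det M) A = 0].

(* The Levi-Civita covariant derivative of the metric induced by the Euclidean
   space 'M[R]_n is the tangential part of the flat derivative, so A is a
   geodesic iff A'' is normal to SL(n). Two derivatives are enough: by
   geodesicSLP, A then solves an ODE that forces it to be smooth. *)
Definition geodesicSL (R : realType) (n : nat) (A : R -> 'M[R]_n) : Prop :=
  [/\ forall t, SL (A t),
      forall t, derivable A t 1,
      forall t, derivable (derive1 A) t 1 &
      forall t X, tangentSL (A t) X -> hsdot (derive1 (derive1 A) t) X = 0].

Definition normalSL (R : realType) (n : nat) (A : 'M[R]_n) : 'M[R]_n :=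
  (hsnorm (invmx A)^T)^-1 *: (invmx A)^T.

(* The second fundamental form at A with respect to normalSL A; the sign
   convention is the one for which geodesicSL_acceleration holds. *)
Definition secondFF (R : realType) (n : nat) (A X Y : 'M[R]_n) : R :=
  \tr (invmx A *m X *m invmx A *m Y) / hsnorm (invmx A).

Section Facts.
Variable R : realType.

Lemma is_derive_prod_seq (V : normedModType R) (I : eqType) (r : seq I)
    (f : I -> V -> R) (x v : V) (d : I -> R) :
  uniq r -> (forall i, is_derive x v (f i) (d i)) ->
  is_derive x v (fun y => \prod_(i <- r) f i y)
    (\sum_(i <- r) d i * \prod_(j <- r | j != i) f j x).
Proof.
move=> + df; elim: r => [_|i r IH /= /andP[ir ur]].
  rewrite big_nil (_ : (fun _ => _) = cst 1); first exact: is_derive_cst.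
  by apply/funext => y; rewrite big_nil.
have {}IH := IH ur.
rewrite (_ : (fun y => _) = f i * (fun y => \prod_(j <- r) f j y)); last first.
  by apply/funext => y; rewrite big_cons.
apply: is_derive_eq.
rewrite big_cons big_cons eqxx /= addrC; congr (_ + _).
  rewrite /GRing.scale /= mulrC; congr (_ * _).
  rewrite [RHS]big_seq_cond [LHS]big_seq; apply: eq_bigl => j.
  by case: eqVneq => [->|]; rewrite ?(negbTE ir) ?andbT ?andbF.
rewrite /GRing.scale /= big_distrr /=; apply: eq_big_seq => j jr.
rewrite big_cons (_ : i != j); last by apply: contraNneq ir => ->.
by rewrite mulrCA.
Qed.

Lemma is_derive_prod (V : normedModType R) (I : finType)
    (f : I -> V -> R) (x v : V) (d : I -> R) :
  (forall i, is_derive x v (f i) (d i)) ->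
  is_derive x v (fun y => \prod_i f i y)
    (\sum_i d i * \prod_(j | j != i) f j x).
Proof. by apply: is_derive_prod_seq; exact: index_enum_uniq. Qed.

Lemma is_derive_fsum (V : normedModType R) (I : finType)
    (f : I -> V -> R) (x v : V) (d : I -> R) :
  (forall i, is_derive x v (f i) (d i)) ->
  is_derive x v (fun y => \sum_i f i y) (\sum_i d i).
Proof.
move=> df; rewrite (_ : (fun y => _) = \sum_i f i); last first.
  by apply/funext => y; rewrite fct_sumE.
by elim/big_ind2 : _ => // [|] *; [exact: is_derive_cst|exact: is_deriveD].
Qed.

Lemma is_derive_mxP (V : normedModType R) (m n : nat) (M : V -> 'M[R]_(m, n))
    (x v : V) (dM : 'M[R]_(m, n)) :
  is_derive x v M dM <-> forall i j, is_derive x v (fun y => M y i j) (dM i j).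
Proof.
split=> [[Mx <-] i j|H].
  split; first by move/derivable_mxP : Mx.
  by rewrite derive_mx// mxE.
have Mx : derivable M x v by apply/derivable_mxP => i j; case: (H i j).
by split=> //; rewrite derive_mx//; apply/matrixP => i j; rewrite mxE derive_val.
Qed.

Lemma is_derive_mulmx (V : normedModType R) (m n p : nat)
    (M : V -> 'M[R]_(m, n)) (N : V -> 'M[R]_(n, p)) (x v : V) dM dN :
  is_derive x v M dM -> is_derive x v N dN ->
  is_derive x v (fun y => M y *m N y) (dM *m N x + M x *m dN).
Proof.
move=> /is_derive_mxP HM /is_derive_mxP HN; apply/is_derive_mxP => i j.
rewrite (_ : (fun y => _) = fun y => \sum_k M y i k * N y k j); last first.
  by apply/funext => y; rewrite mxE.
apply: is_derive_eq.
  apply: is_derive_fsum => k; exact: (is_deriveM (HM i k) (HN k j)).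
rewrite !mxE -big_split /=; apply: eq_bigr => k _.
by rewrite /GRing.scale /= addrC [N x k j * _]mulrC.
Qed.

Lemma is_derive_tr (V : normedModType R) (n : nat) (M : V -> 'M[R]_n)
    (x v : V) dM :
  is_derive x v M dM -> is_derive x v (fun y => \tr (M y)) (\tr dM).
Proof.
by move=> /is_derive_mxP HM; apply: is_derive_fsum => i; exact: HM.
Qed.

Lemma is_derive_det (V : normedModType R) (n : nat) (M : V -> 'M[R]_n)
    (x v : V) dM :
  is_derive x v M dM ->
  is_derive x v (fun y => \det (M y)) (\tr (\adj (M x) *m dM)).
Proof.
move=> /is_derive_mxP HM; apply: is_derive_eq.
  apply: is_derive_fsum => s.
  apply: (@is_deriveZ _ _ _ (fun y => \prod_i M y i (s i))
                      ((-1) ^+ s)).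
  apply: is_derive_prod => i; exact: HM.
rewrite mxtrace_mulC /mxtrace.
transitivity (\sum_i \sum_(s : 'S_n) (-1) ^+ s *
    (dM i (s i) * \prod_(j | j != i) M x j (s j))).
  rewrite exchange_big /=; apply: eq_bigr => s _.
  by rewrite /GRing.scale /= big_distrr.
apply: eq_bigr => i _; rewrite mxE.
rewrite (partition_big (fun s : 'S_n => s i) xpredT) //=.
apply: eq_bigr => j _; rewrite mxE expand_cofactor big_distrr /=.
apply: eq_bigr => s /eqP <-; rewrite mulrCA; do 2 congr (_ * _).
by apply: eq_bigl => k; rewrite eq_sym.
Qed.

Lemma SL_unitmx (n : nat) (A : 'M[R]_n) : SL A -> A \in unitmx.
Proof. by rewrite /SL /= unitmxE => ->; exact: unitr1. Qed.

Lemma SL_invmx (n : nat) (A : 'M[R]_n) : SL A -> invmx A = \adj A.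
Proof.
by move=> AS; rewrite /invmx SL_unitmx//; move: AS => /= ->; rewrite invr1 scale1r.
Qed.

Lemma tangentSLP (n : nat) (A X : 'M[R]_n) :
  SL A -> tangentSL A X <-> \tr (invmx A *m X) = 0.
Proof.
move=> AS; rewrite /tangentSL /= SL_invmx//.
have H : is_derive A X (fun M : 'M[R]_n => \det M) (\tr (\adj A *m X)).
  by apply: (@is_derive_det _ _ id); exact: is_derive_id.
by rewrite derive_val.
Qed.

Lemma hsdot_ge0 (n : nat) (A : 'M[R]_n) : 0 <= hsdot A A.
Proof.
apply: sumr_ge0 => i _; rewrite mxE; apply: sumr_ge0 => j _.
by rewrite mxE -expr2 sqr_ge0.
Qed.

Lemma hsdot_eq0 (n : nat) (A : 'M[R]_n) : hsdot A A = 0 -> A = 0.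
Proof.
have H i j : 0 <= A i j * A^T j i by rewrite mxE -expr2 sqr_ge0.
move=> /eqP; rewrite /hsdot /mxtrace psumr_eq0 => [/allP A0|i _]; last first.
  by rewrite mxE; exact: sumr_ge0.
apply/matrixP => i j; rewrite [RHS]mxE.
have := A0 i (mem_index_enum _) => /=; rewrite mxE psumr_eq0 // => /allP.
by move=> /(_ j (mem_index_enum _)) /=; rewrite mxE mulf_eq0 orbb => /eqP.
Qed.

Lemma hsnorm_sqr (n : nat) (A : 'M[R]_n) : hsnorm A ^+ 2 = hsdot A A.
Proof. by rewrite sqr_sqrtr// hsdot_ge0. Qed.

Lemma hsdotDl (n : nat) (A B C : 'M[R]_n) :
  hsdot (A + B) C = hsdot A C + hsdot B C.
Proof. by rewrite /hsdot mulmxDl mxtraceD. Qed.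

Lemma hsdotZl (n : nat) c (A B : 'M[R]_n) :
  hsdot (c *: A) B = c * hsdot A B.
Proof. by rewrite /hsdot -scalemxAl mxtraceZ. Qed.

Lemma hsdot_trl (n : nat) (A X : 'M[R]_n) : hsdot A^T X = \tr (A *m X).
Proof. by rewrite /hsdot -trmx_mul mxtrace_tr mxtrace_mulC. Qed.

Lemma hsdotC (n : nat) (A B : 'M[R]_n) : hsdot A B = hsdot B A.
Proof. by rewrite /hsdot -mxtrace_tr trmx_mul trmxK. Qed.

(* The curve velocity is tangent, and the normal part of the acceleration of
   any curve in SL(n) is determined by the velocity. *)
Lemma SL_curve (n : nat) (A : R -> 'M[R]_n) :
  (forall t, SL (A t)) -> (forall t, derivable A t 1) ->
  (forall t, derivable (derive1 A) t 1) ->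
  forall t, tangentSL (A t) (derive1 A t) /\
    \tr (invmx (A t) *m derive1 (derive1 A) t) =
    \tr (derive1 A t *m invmx (A t) *m derive1 A t *m invmx (A t)).
Proof.
move=> AS dA ddA.
have HA t : is_derive (t : R) (1 : R) A (derive1 A t).
  by rewrite derive1E; exact: derivableP.
have HA' t : is_derive (t : R) (1 : R) (derive1 A) (derive1 (derive1 A) t).
  by rewrite [derive1 (derive1 A) t]derive1E; exact: derivableP.
have trA t : \tr (invmx (A t) *m derive1 A t) = 0.
  rewrite SL_invmx//; have [_ <-] := is_derive_det (HA t).
  rewrite (_ : (fun y => _) = cst 1) ?derive_cst//.
  by apply/funext => y; exact: AS.
move=> t; split; first exact/tangentSLP.
have dB : derivable (fun s => invmx (A s)) t 1.
  rewrite (_ : (fun s => _) = fun s => \adj (A s)); last first.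
    by apply/funext => s; rewrite SL_invmx.
  apply/derivable_mxP => i j.
  have E : (fun s => (\adj (A s)) i j) =
      (-1) ^+ (j + i) \*: (fun s => \det (row' j (col' i (A s)))).
    by apply/funext => s; rewrite mxE.
  rewrite E; apply: derivableZ.
  have H : is_derive (t : R) (1 : R) (fun s => row' j (col' i (A s)))
      (row' j (col' i (derive1 A t))).
    apply/is_derive_mxP => k l.
    have /is_derive_mxP/(_ (lift j k) (lift i l)) := HA t.
    by rewrite (_ : (fun s => row' _ _ _ _) = fun s => A s (lift j k) (lift i l));
      [rewrite !mxE|apply/funext => s; rewrite !mxE].
  by have [] := is_derive_det H.
have /derivableP := dB; set B' := 'D_1 _ t => HB.
have B'A : B' *m A t + invmx (A t) *m derive1 A t = 0.
  have [_ <-] := is_derive_mulmx HB (HA t).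
  rewrite (_ : (fun y => _) = cst 1%:M) ?derive_cst//.
  by apply/funext => y; rewrite mulVmx// SL_unitmx.
have {B'A} B'E : B' = - (invmx (A t) *m derive1 A t *m invmx (A t)).
  move/eqP: B'A; rewrite addr_eq0 => /eqP/(congr1 (mulmxr (invmx (A t)))) /=.
  by rewrite mulmxK ?SL_unitmx// mulNmx.
have /is_derive_tr [_] := is_derive_mulmx HB (HA' t).
rewrite (_ : (fun y => _) = cst 0); last exact/funext.
rewrite derive_cst mxtraceD B'E mulNmx raddfN /= => /esym/eqP.
rewrite addrC subr_eq0 => /eqP ->.
by rewrite -!mulmxA [RHS]mxtrace_mulC -!mulmxA [RHS]mxtrace_mulC -!mulmxA
  [LHS]mxtrace_mulC -!mulmxA.
Qed.

Lemma geodesicSLP (n : nat) (A : R -> 'M[R]_n) :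
  (0 < n)%N ->
  geodesicSL A <->
  [/\ forall t, SL (A t),
      forall t, derivable A t 1,
      forall t, derivable (derive1 A) t 1 &
      forall t, derive1 (derive1 A) t =
        (\tr (derive1 A t *m invmx (A t) *m derive1 A t *m invmx (A t)) /
         \tr (invmx (A t) *m (invmx (A t))^T)) *: (invmx (A t))^T].
Proof.
move=> n0; split=> -[AS dA ddA H]; split=> // t; last first.
  by move=> X /tangentSLP XT; rewrite H hsdotZl hsdot_trl XT ?mulr0.
have [_ <-] := SL_curve AS dA ddA t.
set B := invmx (A t); set A2 := derive1 (derive1 A) t.
have BB : hsdot B B != 0.
  apply/negP => /eqP/hsdot_eq0 B0.
  have := mulVmx (SL_unitmx (AS t)); rewrite -/B B0 mul0mx.
  move=> /(congr1 (fun M : 'M[R]_n => M (Ordinal n0) (Ordinal n0))).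
  by rewrite !mxE eqxx /= => /eqP; rewrite eq_sym oner_eq0.
rewrite -/(hsdot B B); set l := _ / _.
have BT : \tr (B *m (A2 - l *: B^T)) = 0.
  by rewrite mulmxBr raddfB /= -scalemxAr mxtraceZ -/(hsdot B B) divfK ?subrr.
have XT : tangentSL (A t) (A2 - l *: B^T) by apply/tangentSLP.
apply/eqP; rewrite -subr_eq0; apply/eqP/hsdot_eq0.
by rewrite hsdotDl -scaleNr hsdotZl hsdot_trl scaleNr BT mulr0 addr0 H.
Qed.

(* Gauss formula along a geodesic. *)
Lemma geodesicSL_acceleration (n : nat) (A : R -> 'M[R]_n) :
  (0 < n)%N -> geodesicSL A ->
  forall t, derive1 (derive1 A) t = secondFF (A t) (derive1 A t) (derive1 A t) *: normalSL (A t).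
Proof.
move=> n0 /geodesicSLP-/(_ n0)[AS dA ddA H] t; rewrite H.
rewrite /secondFF /normalSL scalerA; set B := invmx (A t).
have -> : hsnorm B^T = hsnorm B by rewrite /hsnorm hsdot_trl.
rewrite -/(hsdot B B) -hsnorm_sqr expr2 invfM [in LHS]mulrA.
congr (_ / _ / _ *: _).
by rewrite -!mulmxA [RHS]mxtrace_mulC -!mulmxA.
Qed.

End Facts.

(* Main.v *)
(* Write g = |A|^2. The speed |A'| is a constant v because A'' is normal, and
   the position has normal component <A, A^-T> = n > 0, so where II > 0 we get
   g'' = 2 (v^2 + <A'', A>) >= 2 v^2. Hence g grows at least quadratically,
   while the constant speed gives the linear upper bound on |A|. *)
Require Import Defs.
From HB Require Import structures.
From mathcomp Require Import all_boot all_order all_algebra all_fingroup.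
From mathcomp Require Import all_classical all_reals all_analysis.
From mathcomp Require Import ring lra.
Import Order.TTheory GRing.Theory Num.Theory.
Import numFieldNormedType.Exports.
Local Open Scope classical_set_scope.
Local Open Scope ring_scope.

Lemma hsdotDr (R : realType) (n : nat) (A B C : 'M[R]_n) :
  hsdot A (B + C) = hsdot A B + hsdot A C.
Proof. by rewrite hsdotC hsdotDl !(hsdotC A). Qed.

Lemma hsdotZr (R : realType) (n : nat) c (A B : 'M[R]_n) :
  hsdot A (c *: B) = c * hsdot A B.
Proof. by rewrite hsdotC hsdotZl (hsdotC A). Qed.

Lemma hsdotNl (R : realType) (n : nat) (A B : 'M[R]_n) :
  hsdot (- A) B = - hsdot A B.
Proof. by rewrite -scaleN1r hsdotZl mulN1r. Qed.

Lemma hsdotNr (R : realType) (n : nat) (A B : 'M[R]_n) :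
  hsdot A (- B) = - hsdot A B.
Proof. by rewrite hsdotC hsdotNl (hsdotC A). Qed.

(** Parallelogram law. With X = A(t) - A(a) and Y = A(a) it bounds |A(t)|^2 by 2|A(t) - A(a)|^2 +
    2|A(a)|^2. *)
Lemma hsdot_add_sub (R : realType) (n : nat) (X Y : 'M[R]_n) :
  hsdot (X + Y) (X + Y) + hsdot (X - Y) (X - Y) =
  2 * hsdot X X + 2 * hsdot Y Y.
Proof. rewrite !(hsdotDl, hsdotDr, hsdotNl, hsdotNr); ring. Qed.

(** Expansion of |X - Y|^2 >= 0; it stands in for Cauchy-Schwarz below. *)
Lemma hsdot_le_half (R : realType) (n : nat) (X Y : 'M[R]_n) :
  2 * hsdot X Y <= hsdot X X + hsdot Y Y.
Proof.
have := hsdot_ge0 (X - Y).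
by rewrite !(hsdotDl, hsdotDr, hsdotNl, hsdotNr) (hsdotC Y X); lra.
Qed.

Lemma is_derive_hsdot (R : realType) (n : nat) (M N : R -> 'M[R]_n) (t : R)
    (dM dN : 'M[R]_n) :
  is_derive t 1 M dM -> is_derive t 1 N dN ->
  is_derive t 1 (fun s => hsdot (M s) (N s))
    (hsdot dM (N t) + hsdot (M t) dN).
Proof.
move=> HM HN; rewrite /hsdot -raddfD /=; apply: is_derive_tr.
apply: is_derive_mulmx => //; apply/is_derive_mxP => i j.
rewrite mxE (_ : (fun y => _) = fun y => N y j i).
  by move/is_derive_mxP : HN.
by apply/funext => y; rewrite mxE.
Qed.

Lemma mean_value (R : realType) (f df : R -> R) (a b : R) :
  (forall x : R, is_derive x 1 f (df x)) -> a <= b ->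
  exists2 c, a <= c <= b & f b - f a = df c * (b - a).
Proof.
move=> fdf ab.
have [c cab E] : exists2 c, c \in `[a, b] & f b - f a = df c * (b - a).
  apply: MVT_segment => //; apply: continuous_subspaceT => x.
  by apply: differentiable_continuous; apply/derivable1_diffP; case: (fdf x).
by exists c; rewrite // in_itv /= in cab.
Qed.

Section Geodesic.
Variables (R : realType) (n : nat) (A : R -> 'M[R]_n).
Hypotheses (hn : (0 < n)%N) (hA : geodesicSL A).

Lemma geodesicSL_derive1 (t : R) : is_derive t 1 A (derive1 A t).
Proof. by case: hA => _ dA _ _; rewrite derive1E; exact: derivableP. Qed.

Lemma geodesicSL_derive2 (t : R) :
  is_derive t 1 (derive1 A) (derive1 (derive1 A) t).
Proof.
by case: hA => _ _ ddA _; rewrite [derive1 (derive1 A) t]derive1E; exact: derivableP.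
Qed.

(** The derivative of |A'|^2 is 2<A'', A'>, which vanishes because A' is tangent and A'' is
    normal. *)
Lemma geodesicSL_speed (s t : R) :
  hsdot (derive1 A s) (derive1 A s) = hsdot (derive1 A t) (derive1 A t).
Proof.
apply: (@is_derive_0_is_cst _ (fun u => hsdot (derive1 A u) (derive1 A u))) => u.
have := is_derive_hsdot _ _ _ _ _ _ _ (geodesicSL_derive2 u) (geodesicSL_derive2 u).
case: hA => AS dA ddA nA; have [uT _] := SL_curve AS dA ddA u.
by rewrite (hsdotC (derive1 A u)) nA ?addr0.
Qed.

(** By the Gauss formula A'' is a multiple of A^-T, and <A^-T, A> = tr(A^-1 A) = n. *)
Lemma geodesicSL_acceleration_dot (t : R) :
  hsdot (derive1 (derive1 A) t) (A t) =
  secondFF (A t) (derive1 A t) (derive1 A t) * (n%:R / hsnorm (invmx (A t))^T).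
Proof.
have [AS _ _ _] := hA.
rewrite geodesicSL_acceleration// /normalSL !hsdotZl hsdot_trl mulVmx ?SL_unitmx//.
by rewrite mxtrace1 (mulrC n%:R).
Qed.

(** A chord is no longer than its arc. For B = A(t) - A(s), the mean value theorem applied to the
    scalar function <A(u), B> gives |B|^2 = (t - s)<A'(c), B>. Twice this is at most (t - s)^2
    |A'(c)|^2 + |B|^2, and one |B|^2 cancels. *)
Lemma geodesicSL_dist (s t : R) : s <= t ->
  hsdot (A t - A s) (A t - A s) <=
  (t - s) ^+ 2 * hsdot (derive1 A s) (derive1 A s).
Proof.
move=> st; set B := A t - A s.
have dB (u : R) : is_derive u 1 (fun u => hsdot (A u) B) (hsdot (derive1 A u) B).
  have := is_derive_hsdot _ _ _ _ _ _ _ (geodesicSL_derive1 u) (is_derive_cst B u 1).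
  (* The zero derivative of the constant [B] is written as [0 *: 0] so that [hsdotZr] applies. *)
  by rewrite -(scale0r 0) hsdotZr mul0r addr0.
have [c _] := mean_value _ _ _ _ _ dB st.
have -> : hsdot (A t) B - hsdot (A s) B = hsdot B B.
  by rewrite -hsdotNl -hsdotDl.
have := hsdot_le_half _ _ ((t - s) *: derive1 A c) B.
by rewrite !(hsdotZl, hsdotZr) (geodesicSL_speed c s); lra.
Qed.

(** The function [k], which is |A(s)|^2 - (s - a)^2 v, has second derivative 2<A'', A> >= 0 on s >=
    a, so it lies above its tangent line at a. *)
Lemma geodesicSL_lower (a t : R) : a <= t ->
  (forall s, a <= s -> 0 <= secondFF (A s) (derive1 A s) (derive1 A s)) ->
  hsdot (A a) (A a) + 2 * hsdot (derive1 A a) (A a) * (t - a) <=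
  hsdot (A t) (A t) - (t - a) ^+ 2 * hsdot (derive1 A a) (derive1 A a).
Proof.
move=> at_ II0; set v := hsdot (derive1 A a) (derive1 A a).
pose k s := hsdot (A s) (A s) - (s - a) ^+ 2 * v.
pose k1 s := 2 * hsdot (derive1 A s) (A s) - 2 * (s - a) * v.
pose k2 s := 2 * hsdot (derive1 (derive1 A) s) (A s).
have dk (s : R) : is_derive s 1 k (k1 s).
  have dg := is_derive_hsdot _ _ _ _ _ _ _ (geodesicSL_derive1 s) (geodesicSL_derive1 s).
  apply: is_derive_eq; rewrite /k1 (hsdotC (A s)) /GRing.scale /=; ring.
have dk1 (s : R) : is_derive s 1 k1 (k2 s).
  have dg := is_derive_hsdot _ _ _ _ _ _ _ (geodesicSL_derive2 s) (geodesicSL_derive1 s).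
  apply: is_derive_eq; rewrite /k2 (geodesicSL_speed s a) /GRing.scale /= -/v; ring.
(* Convexity by two mean values: [k2 d >= 0] gives [k1 a <= k1 c], and [k1 c] is the slope of the
   chord of [k] over [a, t]. *)
have [c /andP[ac ct] E] := mean_value _ _ _ _ _ dk at_.
have [d /andP[ad dc] E1] := mean_value _ _ _ _ _ dk1 ac.
have k2d : 0 <= k2 d.
  rewrite /k2 geodesicSL_acceleration_dot mulr_ge0// mulr_ge0 ?II0//.
  by rewrite divr_ge0 ?sqrtr_ge0.
have k1c : k1 a <= k1 c by rewrite -subr_ge0 E1 mulr_ge0 ?subr_ge0.
have : k1 a * (t - a) <= k1 c * (t - a) by rewrite ler_wpM2r ?subr_ge0.
by rewrite -E /k /k1 subrr; lra.
Qed.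

End Geodesic.

Theorem proposition2p27 (R : realType) (n : nat) (A : R -> 'M[R]_n) (t0 : R)
  (hn : (2 <= n)%N)
  (hA : geodesicSL A)
  (hII : forall t : R, t0 < t -> 0 < secondFF (A t) (derive1 A t) (derive1 A t)) :
  exists c C : R,
    [/\ 0 < c, c <= C &
        \forall t \near +oo, c * t <= hsnorm (A t) <= C * t].
Proof.
have n0 : (0 < n)%N by exact: leq_trans hn.
(* A base point strictly beyond [t0], so that II is positive on the whole closed ray from [a]. *)
pose a := t0 + 1.
have ta s : a <= s -> t0 < s by rewrite /a; lra.
set v := hsdot (derive1 A a) (derive1 A a).
have v0 : 0 < v.
  rewrite lt_def hsdot_ge0 andbT; apply/eqP => /hsdot_eq0 A'0.
  by have := hII a (ta a (lexx _)); rewrite /secondFF A'0 mulmx0 mxtrace0 mul0r ltxx.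
pose p := hsdot (A a) (A a); pose q := 2 * hsdot (derive1 A a) (A a).
have p0 : 0 <= p := hsdot_ge0 _.
(* For t >= 1 the lower bound v(t - a)^2 + q(t - a) + p is at least v t^2 - M t. Once t >= 2M/v, the
   loss M t is at most half of v t^2, whence c^2 = v/2. *)
pose M := `|q| + 2 * v * `|a| + `|q| * `|a|.
exists (Num.sqrt (v / 2)), (Num.sqrt (2 * v * (1 + `|a|) ^+ 2 + 2 * p)); split.
- by rewrite sqrtr_gt0; lra.
- by apply: ler_wsqrtr; have := normr_ge0 a; nra.
near=> t.
have t1 : 1 <= t by near: t; apply: nbhs_pinfty_ge; exact: num_real.
have at_ : a <= t by near: t; apply: nbhs_pinfty_ge; exact: num_real.
have Mt : 2 * M / v <= t by near: t; apply: nbhs_pinfty_ge; exact: num_real.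
have {}Mt : 2 * M <= t * v by rewrite -ler_pdivrMr.
have t_ge0 : 0 <= t by lra.
have sqE x : 0 <= x -> Num.sqrt x * t = Num.sqrt (x * t ^+ 2).
  by move=> x0; rewrite sqrtrM// sqrtr_sqr ger0_norm.
have /ler_normlP[a1 a2] := lexx `|a|; have /ler_normlP[q1 q2] := lexx `|q|.
have na0 := normr_ge0 a; have nq0 := normr_ge0 q.
rewrite !sqE; [|by nra|by lra].
apply/andP; split; apply: ler_wsqrtr.
- have := geodesicSL_lower _ _ _ n0 hA _ _ at_ (fun s h => ltW (hII s (ta s h))).
  rewrite -/v -/p -/q.
  have h1 : - q * t <= `|q| * t by rewrite ler_wpM2r.
  have h2 : q * a <= `|q| * `|a| by rewrite (le_trans (ler_norm _))// normrM.
  have h3 : `|q| * `|a| <= `|q| * `|a| * t by rewrite ler_peMr// mulr_ge0.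
  have h4 : v * t * a <= v * t * `|a| by rewrite ler_wpM2l// mulr_ge0// ltW.
  have h5 : 2 * M * t <= t * v * t by rewrite ler_wpM2r.
  have h6 : 0 <= v * a ^+ 2 by rewrite mulr_ge0 ?sqr_ge0// ltW.
  rewrite /M in h5; lra.
- have := geodesicSL_dist _ _ _ hA _ _ at_; rewrite -/v => dist.
  have := hsdot_add_sub _ _ (A t - A a) (A a); rewrite subrK -/p => par.
  have := hsdot_ge0 (A t - A a - A a) => ge0.
  (* Since t >= 1, 0 <= t - a <= t + |a| <= (1 + |a|) t; this and the parallelogram law dictate the
     choice of C. *)
  have h1 : (t - a) ^+ 2 * v <= ((1 + `|a|) * t) ^+ 2 * v.
    rewrite ler_wpM2r ?(ltW v0)// ler_sqr ?nnegrE; nra.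
  have h2 : p <= p * t ^+ 2 by rewrite ler_peMr// expr_ge1.
  rewrite exprMn in h1; lra.
Unshelve. all: by end_near.
Qed.
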